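(* Let $\Gamma$ be a finite group and $F$ a $\Gamma$-species. The ordinary cycle index of the quotient species $F/\Gamma$ is $$Z_{F/\Gamma}=\frac1{|\Gamma|}\sum_{\gamma\in\Gamma}Z^{\Gamma}_F(\gamma)=\frac{1}{|\Gamma|}\sum_{\gamma\in\Gamma}\sum_{n\ge0}\frac{1}{n!}\sum_{\sigma\in\mathfrak S_n}\operatorname{fix}(\gamma\cdot F[\sigma])\,p_\sigma .$$
   Context: A species is a functor $F$ from finite sets with bijections to finite sets with maps. A $\Gamma$-species is a species $F$ with an action of $\Gamma$ by species isomorphisms: for each finite set $A$, $\Gamma$ acts on $F[A]$, and $\gamma\cdot F[\sigma](s)=F[\sigma](\gamma\cdot s)$ for every bijection $\sigma:A\to B$, $s\in F[A]$, $\gamma\in\Gamma$. The quotient species $F/\Gamma$ has $(F/\Gamma)[A]$ equal to the set of $\Gamma$-orbits on $F[A]$, with induced transport. For $\sigma\in\mathfrak S_n$, $p_\sigma=\prod_i p_i^{\sigma_i}$ with $\sigma_i$ the number of $i$-cycles of $\sigma$ and $p_1,p_2,\dots$ indeterminates; $\operatorname{fix}$ denotes the number of fixed points of a self-map. $F[\sigma]$ is taken on $F[\{1,\dots,n\}]$. The cycle index of a species is $Z_F=\sum_{n\ge0}\frac1{n!}\sum_{\sigma\in\mathfrak S_n}\operatorname{fix}(F[\sigma])p_\sigma$, and the $\Gamma$-cycle index of a $\Gamma$-species is $Z^\Gamma_F(\gamma)=\sum_{n\ge0}\frac1{n!}\sum_{\sigma\in\mathfrak S_n}\operatorname{fix}(\gamma\cdot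 F[\sigma])p_\sigma$, where $\gamma\cdot F[\sigma]$ is the composite map. *)

(* Defs.v *)
From HB Require Import structures.
From mathcomp Require Import all_boot all_algebra fingroup perm.
From mathcomp Require Import finmap.
From mathcomp Require Import boolp classical_sets functions cardinality fsbigop.
From mathcomp Require Import monalg.

Set Implicit Arguments.
Unset Strict Implicit.
Unset Printing Implicit Defensive.

Import GRing.Theory.
Local Open Scope ring_scope.

(* Functors from finite sets with bijections to finite sets with maps.  The
   laws quantify over all proofs of bijectivity, so transport depends only on
   the underlying function. *)
Record species := Species {
  sp_obj :> finType -> finType;
  sp_map : forall (A B : finType) (f : A -> B),
    bijective f -> sp_obj A -> sp_obj B;
  sp_map_id : forall (A : finType) (h : bijective (@id A)) (s : sp_obj A),
    sp_map h s = s;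
  sp_map_comp : forall (A B C : finType) (f : A -> B) (g : B -> C)
      (hf : bijective f) (hg : bijective g) (hgf : bijective (g \o f))
      (s : sp_obj A),
    sp_map hgf s = sp_map hg (sp_map hf s) }.

(* Left actions, unlike the right actions of the fingroup library. *)
Record gspecies (gT : finGroupType) := GSpecies {
  gsp_species :> species;
  sp_act : forall A : finType, gT -> gsp_species A -> gsp_species A;
  sp_act1 : forall (A : finType) (s : gsp_species A), sp_act 1%g s = s;
  sp_actM : forall (A : finType) (a b : gT) (s : gsp_species A),
    sp_act (a * b)%g s = sp_act a (sp_act b s);
  sp_act_map : forall (A B : finType) (f : A -> B) (hf : bijective f) (a : gT)
      (s : gsp_species A),
    sp_act a (sp_map hf s) = sp_map hf (sp_act a s) }.

Section Quotient.
Variables (gT : finGroupType) (F : gspecies gT).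

Definition gorbit (A : finType) (s : F A) : {set F A} :=
  [set sp_act a s | a : gT].

Definition gorbits (A : finType) : {set {set F A}} :=
  [set gorbit s | s : F A].

Definition quot_obj (A : finType) : finType :=
  {O : {set F A} | O \in gorbits A}.

Lemma quot_map_subproof (A B : finType) (f : A -> B) (hf : bijective f)
    (O : quot_obj A) :
  [set sp_map hf s | s in val O] \in gorbits B.
Proof.
case: O => O /= /imsetP[s _ ->]; apply/imsetP; exists (sp_map hf s) => //.
rewrite /gorbit -imset_comp; apply: eq_imset => a /=.
by rewrite sp_act_map.
Qed.

Definition quot_map (A B : finType) (f : A -> B) (hf : bijective f)
    (O : quot_obj A) : quot_obj B :=
  Sub [set sp_map hf s | s in val O] (quot_map_subproof hf O).

Lemma quot_map_id (A : finType) (h : bijective (@id A)) (O : quot_obj A) :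
  quot_map h O = O.
Proof.
apply: val_inj; rewrite /= -[RHS]imset_id.
by apply: eq_imset => s; rewrite sp_map_id.
Qed.

Lemma quot_map_comp (A B C : finType) (f : A -> B) (g : B -> C)
    (hf : bijective f) (hg : bijective g) (hgf : bijective (g \o f))
    (O : quot_obj A) :
  quot_map hgf O = quot_map hg (quot_map hf O).
Proof.
apply: val_inj; rewrite /= -imset_comp.
by apply: eq_imset => s /=; rewrite (sp_map_comp hf hg).
Qed.

Definition quot_species : species := Species quot_map_id quot_map_comp.

End Quotient.

Lemma perm_bij (n : nat) (s : 'S_n) : bijective s.
Proof. by exists (s^-1)%g; [exact: permK | exact: permKV]. Qed.

(* F[sigma], with 'I_n playing the role of {1, ..., n}. *)
Definition sp_perm (F : species) (n : nat) (s : 'S_n) : F 'I_n -> F 'I_n :=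
  sp_map (perm_bij s).
Arguments sp_perm F {n} s x.

Definition fix_count (T : finType) (f : T -> T) : nat := #|[set x | f x == x]|.

Definition ncycles (n : nat) (s : 'S_n) (i : nat) : nat :=
  #|[set c in porbits s | #|c| == i]|.

(* Polynomials and formal power series over the rationals in indeterminates
   indexed by nat; only p_1, p_2, ... are used (p_0 never occurs).  A power
   series is the function giving its coefficients; its linear structure is
   pointwise. *)
Notation ppoly := {malg rat[{cmonom nat}]}.
Notation pseries := ({cmonom nat} -> rat^o).

Definition pvar (i : nat) : ppoly := << ucm i >>.

Definition p_perm (n : nat) (s : 'S_n) : ppoly :=
  \prod_(1 <= i < n.+1) pvar i ^+ ncycles s i.

(* The formal sum of a sequence of polynomials, coefficient by coefficient;
   the \sum over [set: nat] has value 0 on families with infinite support. *)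
Definition fsum (u : nat -> ppoly) : pseries :=
  fun m => \sum_(n \in [set: nat]%classic) mcoeff m (u n).

(* The sums below are well defined: a monomial m occurs in p_perm s, for
   s : 'S_n, only if n is the weight of m, where p_i has weight i. *)
Definition cmwgt (m : {cmonom nat}) : nat :=
  (\sum_(i <- finsupp m) i * m i)%N.

Lemma sum_ncycles (n : nat) (s : 'S_n) :
  (\sum_(1 <= i < n.+1) i * ncycles s i)%N = n.
Proof.
have sum_card : (\sum_(c in porbits s) #|c| = n)%N.
  transitivity (\sum_(c in porbits s) \sum_x (x \in c))%N.
    by apply: eq_bigr => c _; rewrite -sum1_card big_mkcond.
  rewrite exchange_big /= -[RHS]card_ord -sum1_card.
  apply: eq_bigr => x _; rewrite (bigD1 (porbit s x)) /=; last exact: imset_f.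
  rewrite porbit_id big1 // => c /andP[/imsetP[y _ ->]].
  by rewrite -eq_porbit_mem eq_sym => /negPf ->.
rewrite -[RHS]sum_card.
transitivity
    (\sum_(1 <= i < n.+1) \sum_(c in porbits s) (#|c| == i) * #|c|)%N.
  apply: eq_bigr => i _; rewrite /ncycles -sum1_card big_distrr /=.
  rewrite [RHS](bigID (fun c : {set 'I_n} => #|c| == i)) /=.
  rewrite [X in (_ + X)%N]big1 ?addn0 => [|c /andP[_ /negPf->]] //.
  apply: eq_big => [c|c]; first by rewrite inE.
  by rewrite inE => /andP[_ /eqP->]; rewrite eqxx muln1 mul1n.
rewrite exchange_big /=; apply: eq_bigr => c cs.
have c_in : #|c| \in index_iota 1 n.+1.
  have c_n : (#|c| <= n)%N by have := max_card (mem c); rewrite card_ord.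
  rewrite mem_index_iota ltnS c_n andbT.
  by case/imsetP: cs => x _ ->; apply/card_gt0P; exists x; exact: porbit_id.
rewrite (bigD1_seq #|c|) ?iota_uniq //= eqxx mul1n big1 ?addn0 // => i.
by rewrite eq_sym => /negPf->.
Qed.

Definition mono (m : {cmonom nat}) : ppoly := << m >>.

Lemma monoM (m1 m2 : {cmonom nat}) : mono (mmul m1 m2) = mono m1 * mono m2.
Proof. by rewrite malgM_def fgmulUU mulr1. Qed.

Lemma mono1 : mono mone = 1.
Proof. exact: mpolyC1E. Qed.

Lemma pvarX (i k : nat) :
  exists2 m : {cmonom nat}, pvar i ^+ k = mono m &
    forall j, m j = if j == i then k else 0%N.
Proof.
elim: k => [|k [m mE mP]].
  by exists mone => [|j]; rewrite ?mono1 ?cm1 ?if_same.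
exists (mmul (ucm i) m) => [|j]; first by rewrite exprS mE monoM.
by rewrite cmM cmU mP eq_sym; case: eqP.
Qed.

Lemma prod_pvar (r : seq nat) (e : nat -> nat) : uniq r ->
  exists2 m : {cmonom nat}, \prod_(i <- r) pvar i ^+ e i = mono m &
    forall i, m i = if i \in r then e i else 0%N.
Proof.
elim: r => [|i r IHr] /= => [_|/andP[ir /IHr[m mE mP]]].
  by exists mone => [|j]; rewrite ?big_nil ?mono1 ?cm1.
have [m' m'E m'P] := pvarX i (e i).
exists (mmul m' m) => [|j]; first by rewrite big_cons mE m'E monoM.
rewrite cmM m'P mP inE; case: eqP => [->|_] //=.
by rewrite (negPf ir) addn0.
Qed.

Lemma mcoeff_p_perm (n : nat) (s : 'S_n) (m : {cmonom nat}) :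
  cmwgt m != n -> mcoeff m (p_perm s) = 0.
Proof.
have [m' m'E m'P] := prod_pvar (ncycles s) (iota_uniq 1 n).
rewrite /p_perm /index_iota subn1 /= m'E mcoeffU.
case: (m' =P m) => [<- | _ _]; last by rewrite mulr0n.
suff -> : cmwgt m' = n by rewrite eqxx.
rewrite -[RHS](sum_ncycles s) /index_iota subn1 /=.
transitivity (\sum_(i <- iota 1 n) i * m' i)%N; last first.
  by apply: eq_big_seq => i i_n; rewrite m'P i_n.
rewrite [RHS](bigID (mem (finsupp m'))) /= [X in (_ + X)%N]big1 ?addn0; last first.
  by move=> i; rewrite -cmE_eq0 => /eqP ->; rewrite muln0.
rewrite -[RHS]big_filter; apply/perm_big/uniq_perm.
- exact: fset_uniq.
- exact/filter_uniq/iota_uniq.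
move=> i; rewrite mem_filter andb_idr //= -cmE_neq0 m'P.
by case: ifP.
Qed.

Lemma finite_support_fsum (c : forall n, 'S_n -> rat) (m : {cmonom nat}) :
  finite_set [set n | mcoeff m ((n`!%:R)^-1 *: \sum_(s : 'S_n) c n s *: p_perm s)
                      != 0]%classic.
Proof.
apply: (@sub_finite_set _ _ [set cmwgt m]%classic); last exact: finite_set1.
move=> n /=; apply: contraNeq => ne; rewrite mcoeffZ raddf_sum /= big1 ?mulr0 //.
by move=> s _; rewrite mcoeffZ mcoeff_p_perm ?mulr0 // eq_sym.
Qed.

Definition cycle_index (F : species) : pseries :=
  fsum (fun n => (n`!%:R)^-1 *:
    \sum_(s : 'S_n) (fix_count (sp_perm F s))%:R *: p_perm s).

Definition gcycle_index (gT : finGroupType) (F : gspecies gT) (a : gT) :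
    pseries :=
  fsum (fun n => (n`!%:R)^-1 *:
    \sum_(s : 'S_n) (fix_count (fun x => sp_act a (sp_perm F s x)))%:R *: p_perm s).

(* Main.v *)
Require Import Defs.
From mathcomp Require Import all_boot all_algebra fingroup perm.
From mathcomp Require Import finmap.
From mathcomp Require Import boolp classical_sets functions cardinality fsbigop.
From mathcomp Require Import monalg.
Import GRing.Theory.
Local Open Scope ring_scope.

(** Burnside's counting argument, twisted by the transport [F[sigma]]: if [x]
    lies in an orbit [O] then [a . F[sigma](x) = x] is solvable in [a] exactly
    when [F[sigma]] stabilises [O], and it then has [#|Gamma| / #|O|] solutions.
    Hence each stable orbit contributes [#|Gamma|] pairs [(a, x)]. *)

Section Orbits.
Variables (gT : finGroupType) (F : gspecies gT) (A : finType).
Implicit Types (x y : F A) (a b : gT).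

Lemma sp_actK a : cancel (@sp_act gT F A a) (sp_act a^-1%g).
Proof. by move=> x; rewrite -sp_actM mulVg sp_act1. Qed.

Lemma gorbit_refl x : x \in gorbit x.
Proof. by apply/imsetP; exists 1%g => //; rewrite sp_act1. Qed.

Lemma gorbit_act a x : gorbit (sp_act a x) = gorbit x.
Proof.
apply/setP=> y; apply/imsetP/imsetP => -[b _ ->].
  by exists (b * a)%g; rewrite ?sp_actM.
by exists (b * a^-1)%g; rewrite // sp_actM sp_actK.
Qed.

Lemma gorbit_eqE x y : (gorbit x == gorbit y) = (x \in gorbit y).
Proof.
apply/eqP/idP => [<-|/imsetP[a _ ->]]; first exact: gorbit_refl.
exact: gorbit_act.
Qed.

Lemma gorbit_in x : gorbit x \in gorbits F A.
Proof. exact: imset_f. Qed.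

Definition gorbit_class x : quot_obj F A := exist _ (gorbit x) (gorbit_in x).

(** Orbit-stabiliser without stabilisers: [gT] splits according to the value [sp_act a y], and all
    the classes have the same size because left translations carry one onto another. *)
Lemma card_transporter x y : x \in gorbit y ->
  (#|[set a : gT | sp_act a y == x]| * #|gorbit y| = #|gT|)%N.
Proof.
move=> xy; rewrite -[RHS]sum1_card.
rewrite (partition_big (fun a => sp_act a y) (mem (gorbit y))) /=; last first.
  by move=> a _; apply: imset_f.
rewrite mulnC -sum_nat_const; apply: eq_bigr => z zy.
rewrite sum1_card.
have /imsetP[b _ ->] : z \in gorbit x.
  by move: xy; rewrite -gorbit_eqE => /eqP->.
(* Since [z] is [sp_act b x], the elements sending [y] to [z] are the products [b * c] with [c]
   sending [y] to [x]. *)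
rewrite -(card_imset (mem [set a : gT | sp_act a y == x]) (mulgI b)).
apply: eq_card => a; rewrite [RHS]unfold_in /=; apply/imsetP/eqP => [[c + ->]|ax].
  by rewrite inE => /eqP <-; rewrite sp_actM.
by exists (b^-1 * a)%g; rewrite ?mulKVg // inE sp_actM ax sp_actK.
Qed.

Lemma sp_map_gorbit (f : A -> A) (hf : bijective f) x :
  [set sp_map hf y | y in gorbit x] = gorbit (sp_map hf x).
Proof.
by rewrite /gorbit -imset_comp; apply: eq_imset => a /=; rewrite sp_act_map.
Qed.

Lemma quot_map_class (f : A -> A) (hf : bijective f) x :
  quot_map hf (gorbit_class x) = gorbit_class (sp_map hf x).
Proof. by apply: val_inj; rewrite /= sp_map_gorbit. Qed.

(** For [f] the identity this is the classical orbit-counting lemma. *)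
Lemma fix_count_quot_map (f : A -> A) (hf : bijective f) :
  (#|gT| * fix_count (@quot_map gT F A A f hf) =
   \sum_(a : gT) fix_count (fun x : F A => sp_act a (sp_map hf x)))%N.
Proof.
transitivity
    (\sum_(x : F A) #|[set a : gT | sp_act a (sp_map hf x) == x]|)%N; last first.
  under [RHS]eq_bigr => a _ do rewrite /fix_count -sum1dep_card big_mkcond.
  under eq_bigr => x _ do rewrite -sum1dep_card big_mkcond.
  exact: exchange_big.
(* Both sides become sums over all orbits, to be compared orbit by orbit: the left term is [#|gT|]
   on a fixed orbit and 0 elsewhere. *)
rewrite (partition_big gorbit_class predT) //= mulnC -sum_nat_const big_mkcond.
apply: eq_bigr => -[O OP] _; rewrite inE.
have /imsetP[x0 _ defO] := OP.
have {OP}-> : exist _ O OP = gorbit_class x0 by apply: val_inj.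
rewrite quot_map_class -val_eqE /=.
have eqO x : (gorbit_class x == gorbit_class x0) = (x \in gorbit x0).
  by rewrite -val_eqE /= gorbit_eqE.
rewrite (eq_bigl _ _ eqO).
have orbf x : x \in gorbit x0 ->
    gorbit (sp_map hf x) = gorbit (sp_map hf x0).
  by case/imsetP=> a _ ->; rewrite -sp_act_map gorbit_act.
case: eqP => [stab|nstab].
  have O_gt0 : (0 < #|gorbit x0|)%N by apply/card_gt0P; exists x0; apply: gorbit_refl.
  (* Multiplying by the orbit size avoids division in [nat] and lets [card_transporter] apply to
     each [x] separately. *)
  apply/eqP; rewrite -(eqn_pmul2r O_gt0) big_distrl /= mulnC -sum_nat_const.
  apply/eqP/eq_bigr => x xO; rewrite -stab -(orbf x xO) card_transporter //.
  by rewrite orbf // stab.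
(* A solution [a] would put [x] and [sp_map hf x] in one orbit, making the orbit stable. *)
rewrite big1 // => x xO; apply: eq_card0 => a; rewrite inE; apply/eqP => ax.
by apply: nstab; rewrite -(orbf x xO) -(gorbit_act a) ax; apply/eqP; rewrite gorbit_eqE.
Qed.

End Orbits.

(** By homogeneity of [p_perm], only the degree [n = cmwgt m] contributes to the coefficient of [m],
    so the formal sum reduces to a finite one. *)
Lemma fsum_p_perm (c : forall n, 'S_n -> rat) (m : {cmonom nat}) :
  fsum (fun n => (n`!%:R)^-1 *: \sum_(s : 'S_n) c n s *: p_perm s) m =
  ((cmwgt m)`!%:R)^-1 * \sum_(s : 'S_(cmwgt m)) c _ s * mcoeff m (p_perm s).
Proof.
rewrite /fsum -(@fsbig_widen _ _ _ _ [set cmwgt m]%classic) //; last first.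
  move=> n /= [_ /eqP ne]; rewrite mcoeffZ raddf_sum /= big1 ?mulr0 // => s _.
  by rewrite mcoeffZ mcoeff_p_perm ?mulr0 // eq_sym.
rewrite fsbig_set1 mcoeffZ raddf_sum /=; congr (_ * _).
by apply: eq_bigr => s _; rewrite mcoeffZ.
Qed.

Theorem mainTheorem4 (gT : finGroupType) (F : gspecies gT) :
  cycle_index (quot_species F)
    = (#|gT|%:R)^-1 *: \sum_(a : gT) gcycle_index F a
  /\ (#|gT|%:R)^-1 *: \sum_(a : gT) gcycle_index F a
    = (#|gT|%:R)^-1 *: \sum_(a : gT) fsum (fun n => (n`!%:R)^-1 *:
        \sum_(s : 'S_n)
           (fix_count (fun x => sp_act a (sp_perm F s x)))%:R *: p_perm s).
Proof.
split=> //; apply/funext => m.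
have gT_neq0 : #|gT|%:R != 0 :> rat.
  by rewrite Num.Theory.pnatr_eq0 -lt0n; apply/card_gt0P; exists 1%g.
apply: (mulfI gT_neq0).
have -> : ((#|gT|%:R)^-1 *: \sum_(a : gT) gcycle_index F a : pseries) m
    = (#|gT|%:R)^-1 * \sum_(a : gT) gcycle_index F a m.
  by rewrite fct_sumE.
rewrite mulVKf // /cycle_index
  (fsum_p_perm (fun n s => (fix_count (sp_perm (quot_species F) s))%:R)).
under [RHS]eq_bigr => a _ do rewrite /gcycle_index
  (fsum_p_perm (fun n s => (fix_count (fun x => sp_act a (sp_perm F s x)))%:R)).
(* With the common factorial factor removed and the sums over [a] and [s] exchanged, the orbit count
   applies for each fixed [s]. *)
rewrite -mulr_sumr mulrCA exchange_big /=; congr (_ * _).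
rewrite mulr_sumr; apply: eq_bigr => s _.
by rewrite mulrA -natrM fix_count_quot_map natr_sum mulr_suml.
Qed.
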